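(* Let $A,N_1,\dots,N_m\in\mathbb R^{n\times n}$ with $A$ Hurwitz, $B\in\mathbb R^{n\times m}$, $C\in\mathbb R^{p\times n}$, and $u=(u_1,\dots,u_m)^T\in L^2$. Let $y(t)=Cx(t)$, where $x$ solves $\dot x(t)=Ax(t)+Bu(t)+\sum_{k=1}^m N_kx(t)u_k(t)$, $x(0)=0$. Suppose that $$\sigma\Big(A\otimes I+I\otimes A+\sum_{k=1}^m N_k\otimes N_k\Big)\subset\mathbb C_- .$$ Then $$\sup_{t\ge0}\|y(t)\|_2\le\big(\operatorname{tr}(CPC^T)\big)^{1/2}\exp\{0.5\|u^0\|_{L^2}^2\}\,\|u\|_{L^2},$$ where $P$ is the unique solution to $AP+PA^T+\sum_{k=1}^m N_kPN_k^T=-BB^T$.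
   Context: $\mathbb C_-=\{z\in\mathbb C:\Re z<0\}$, $\sigma(\cdot)$ denotes the spectrum, and $A$ Hurwitz means $\sigma(A)\subset\mathbb C_-$. $L^2$ is the set of $u:[0,\infty)\to\mathbb R^m$ with $\|u\|_{L^2}^2=\int_0^\infty u^T(s)u(s)\,ds<\infty$. The vector $u^0=(u^0_1,\dots,u^0_m)^T$ is defined by $u^0_k\equiv 0$ if $N_k=0$ and $u^0_k=u_k$ otherwise. *)

(* Defs.v *)
From HB Require Import structures.
From mathcomp Require Import all_boot all_order all_algebra.
From mathcomp Require Import all_classical all_reals all_analysis.
From mathcomp Require Import complex mxtens.
Set Implicit Arguments. Unset Strict Implicit. Unset Printing Implicit Defensive.
Import Order.TTheory GRing.Theory Num.Theory.
Local Open Scope ring_scope.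
Local Open Scope classical_set_scope.

Section Defs.
Variable R : realType.
Local Notation mu := (@lebesgue_measure R).

Definition spec_in_Cminus (k : nat) (M : 'M[R]_k) : Prop :=
  forall z : R[i], eigenvalue (map_mx (fun r => (r%:C)%C) M) z -> Re z < 0.

Definition hurwitz (k : nat) (M : 'M[R]_k) : Prop := spec_in_Cminus M.

Definition kron_op (n m : nat) (A : 'M[R]_n) (N : 'I_m -> 'M[R]_n) : 'M[R]_(n * n) :=
  A *t (1%:M : 'M[R]_n) + (1%:M : 'M[R]_n) *t A + \sum_(k < m) (N k *t N k).

Definition lyap_eq (n m : nat) (A : 'M[R]_n) (N : 'I_m -> 'M[R]_n)
    (B : 'M[R]_(n, m)) (P : 'M[R]_n) : Prop :=
  A *m P + P *m A^T + \sum_(k < m) (N k *m P *m (N k)^T) = - (B *m B^T).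

Definition in_L2 (m : nat) (u : R -> 'cV[R]_m) : Prop :=
  (forall k : 'I_m, measurable_fun (`[0%R, +oo[ : set R) (fun s => u s k 0))
  /\ mu.-integrable (`[0%R, +oo[ : set R) (fun s => (\sum_(k < m) (u s k 0) ^+ 2)%:E).

Definition L2norm2 (m : nat) (u : R -> 'cV[R]_m) : R :=
  Rintegral mu (`[0%R, +oo[ : set R) (fun s => \sum_(k < m) (u s k 0) ^+ 2).

Definition L2norm (m : nat) (u : R -> 'cV[R]_m) : R := Num.sqrt (L2norm2 u).

Definition u0 (n m : nat) (N : 'I_m -> 'M[R]_n) (u : R -> 'cV[R]_m) : R -> 'cV[R]_m :=
  fun s => \col_(k < m) (if N k == 0 then 0 else u s k 0).

Definition bil_rhs (n m : nat) (A : 'M[R]_n) (B : 'M[R]_(n, m)) (N : 'I_m -> 'M[R]_n)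
    (u : R -> 'cV[R]_m) (x : R -> 'cV[R]_n) (s : R) : 'cV[R]_n :=
  A *m x s + B *m u s + \sum_(k < m) (u s k 0 *: (N k *m x s)).

(* x is a (Caratheodory / absolutely continuous) solution on [0,oo) of
   x' = A x + B u + sum_k N_k x u_k, x(0) = 0, i.e. for every t >= 0 the
   right-hand side is integrable on [0,t] and x(t) = int_0^t rhs(s) ds. *)
Definition bil_solution (n m : nat) (A : 'M[R]_n) (B : 'M[R]_(n, m))
    (N : 'I_m -> 'M[R]_n) (u : R -> 'cV[R]_m) (x : R -> 'cV[R]_n) : Prop :=
  forall t : R, 0 <= t -> forall i : 'I_n,
    mu.-integrable (`[0%R, t] : set R) (fun s => (bil_rhs A B N u x s i 0)%:E)
    /\ x t i 0 = Rintegral mu (`[0%R, t] : set R) (fun s => bil_rhs A B N u x s i 0).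

Definition norm2 (p : nat) (v : 'cV[R]_p) : R := Num.sqrt (\sum_(i < p) (v i 0) ^+ 2).

End Defs.

(* Main.v *)
(* If [P] is positive definite with [lyap P <= - B B^T], then along solutions the
   energy [V = x^T P^-1 x] satisfies [V' <= |u|^2 + |u0|^2 V], so that
   [V t <= exp (|u0|^2) |u|^2] by Gronwall's inequality, and Cauchy-Schwarz for
   [P] gives [|C x|^2 <= tr (C P C^T) V].  The solution of the Lyapunov equation
   may be singular, so this is applied to [P + e Q] with [lyap Q = - I], and
   then [e] tends to 0.  Positivity of [P + e Q] = [- lyap^-1 W], for [W] positive
   definite, comes from the homotopy [(1 - t) id - t lyap], [0 <= t <= 1], which is
   invertible by the spectral condition: its preimage of [W] cannot become
   singular while it is positive semidefinite. *)
Require Import Defs.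
From HB Require Import structures.
From mathcomp Require Import all_boot all_order all_algebra.
From mathcomp Require Import all_classical all_reals all_analysis.
From mathcomp Require Import complex mxtens.
From mathcomp Require Import ring lra.
Import Order.TTheory GRing.Theory Num.Theory.
Import numFieldNormedType.Exports.
Set Implicit Arguments. Unset Strict Implicit. Unset Printing Implicit Defensive.
Local Open Scope ring_scope.

(** * Quadratic forms, Cauchy-Schwarz and coercivity *)

Section Forms.
Variables (F : realFieldType) (n : nat).
Implicit Types (X Y : 'M[F]_n) (u v w : 'cV[F]_n).

Definition bform X u v : F := (u^T *m X *m v) 0 0.
Definition qform X v : F := bform X v v.
Definition psd X := forall v, 0 <= qform X v.
Definition pd X := forall v, v != 0 -> 0 < qform X v.

Lemma bformC X u v : X^T = X -> bform X u v = bform X v u.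
Proof.
move=> sX; rewrite /bform.
have -> : u^T *m X *m v = (v^T *m X *m u)^T by rewrite !trmx_mul trmxK sX mulmxA.
by rewrite mxE.
Qed.

Lemma bformDl X u v w : bform X (u + v) w = bform X u w + bform X v w.
Proof. by rewrite /bform linearD !mulmxDl mxE. Qed.

Lemma bformDr X u v w : bform X w (u + v) = bform X w u + bform X w v.
Proof. by rewrite /bform !mulmxDr mxE. Qed.

Lemma bformZl X a u v : bform X (a *: u) v = a * bform X u v.
Proof. by rewrite /bform linearZ /= -!scalemxAl mxE. Qed.

Lemma bformZr X a u v : bform X u (a *: v) = a * bform X u v.
Proof. by rewrite /bform -!scalemxAr mxE. Qed.

Lemma bform0 X u : bform X u 0 = 0.
Proof. by rewrite /bform mulmx0 mxE. Qed.

Lemma qformD X Y v : qform (X + Y) v = qform X v + qform Y v.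
Proof. by rewrite /qform /bform mulmxDr mulmxDl mxE. Qed.

Lemma qformZ X a v : qform (a *: X) v = a * qform X v.
Proof. by rewrite /qform /bform -scalemxAr -scalemxAl mxE. Qed.

Lemma qform_sum (I : finType) (X : I -> 'M[F]_n) v :
  qform (\sum_i X i) v = \sum_i qform (X i) v.
Proof. by rewrite /qform /bform mulmx_sumr mulmx_suml summxE. Qed.

Lemma qform_conj (p : nat) (M : 'M[F]_(n, p)) (Z : 'M[F]_p) v :
  qform (M *m Z *m M^T) v = (( M^T *m v)^T *m Z *m (M^T *m v)) 0 0.
Proof. by rewrite /qform /bform trmx_mul trmxK !mulmxA. Qed.

Lemma bform_sum X u v : bform X u v = \sum_i \sum_j u i 0 * X i j * v j 0.
Proof.
rewrite /bform mxE exchange_big; apply: eq_bigr => j _ /=.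
by rewrite mxE mulr_suml; apply: eq_bigr => i _; rewrite mxE.
Qed.

Lemma qform1 v : qform 1%:M v = \sum_i v i 0 ^+ 2.
Proof. by rewrite /qform /bform mulmx1 mxE; apply: eq_bigr => i _; rewrite mxE. Qed.

Lemma qform1_ge0 v : 0 <= qform 1%:M v.
Proof. by rewrite qform1 sumr_ge0// => i _; rewrite sqr_ge0. Qed.

Lemma le_qform1 v i : v i 0 ^+ 2 <= qform 1%:M v.
Proof.
by rewrite qform1 (bigD1 i)//= lerDl sumr_ge0// => j _; rewrite sqr_ge0.
Qed.

Lemma qform1_gt0 v : v != 0 -> 0 < qform 1%:M v.
Proof.
move=> v0; rewrite lt0r qform1_ge0 andbT; apply: contra_neq v0 => q0.
apply/colP => i; rewrite mxE; apply/eqP; rewrite -sqrf_eq0.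
by rewrite eq_le sqr_ge0 andbT -q0 le_qform1.
Qed.

Lemma pd_psd X : pd X -> psd X.
Proof.
move=> pX v; have [->|/pX/ltW//] := eqVneq v 0.
by rewrite /qform bform0.
Qed.

(** The polynomial [t |-> qform X (u + t *: v)] is nonnegative. Only semidefiniteness is available,
    so a vanishing leading coefficient is a separate case. *)
Lemma cauchy_schwarz X u v : X^T = X -> psd X ->
  bform X u v ^+ 2 <= qform X u * qform X v.
Proof.
move=> sX pX.
have key t : 0 <= qform X u + 2 * t * bform X u v + t ^+ 2 * qform X v.
  have := pX (u + t *: v).
  rewrite /qform !(bformDl, bformDr, bformZl, bformZr) (bformC v u sX).
  by congr (_ <= _); ring.
have := pX u; have := pX v.
move: (qform X u) (qform X v) (bform X u v) key => a c b key c0 a0.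
have [c00|cn0] := eqVneq c 0.
  have [->|b0] := eqVneq b 0; first by rewrite expr0n mulr_ge0.
  (* With [c = 0] the polynomial is affine; at this [t] it would equal -1. *)
  have := key (- (a + 1) / (2 * b)).
  have -> : a + 2 * (- (a + 1) / (2 * b)) * b + (- (a + 1) / (2 * b)) ^+ 2 * c
     = -1 by rewrite c00; field.
  by rewrite ler0N1.
have cp : 0 < c by rewrite lt0r cn0.
(* The minimiser of the quadratic. *)
have := key (- b / c).
have -> : a + 2 * (- b / c) * b + (- b / c) ^+ 2 * c = (a * c - b ^+ 2) / c by field.
by rewrite pmulr_lge0 ?invr_gt0// subr_ge0.
Qed.

Lemma pd_unitmx X : pd X -> X \in unitmx.
Proof.
move=> pX; rewrite unitmxE unitfE; apply/negP => /det0P[v v0 vX].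
have := pX v^T; rewrite -(trmx0 F 1 n) (inj_eq trmx_inj) => /(_ v0).
by rewrite /qform /bform trmxK vX mul0mx mxE ltxx.
Qed.

Lemma sym_invmx X : X^T = X -> (invmx X)^T = invmx X.
Proof. by move=> sX; rewrite trmx_inv sX. Qed.

Lemma qform_invmx X v : X^T = X -> X \in unitmx ->
  qform (invmx X) v = qform X (invmx X *m v).
Proof.
by move=> sX uX; rewrite /qform /bform trmx_mul sym_invmx// mulmxKV// mulmxA.
Qed.

Lemma pd_invmx X : X^T = X -> pd X -> pd (invmx X).
Proof.
move=> sX pX v v0; have uX := pd_unitmx pX; rewrite qform_invmx//; apply: pX.
by apply: contra_neq v0 => iv0; rewrite -[v](mulKVmx uX) iv0 mulmx0.
Qed.

(** Cauchy-Schwarz for [X] between [u] and [X^-1 v], since [u^T v = u^T X (X^-1 v)]. *)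
Lemma dot_le_qform X u v : X^T = X -> pd X ->
  ((u^T *m v) 0 0) ^+ 2 <= qform X u * qform (invmx X) v.
Proof.
move=> sX pX; have uX := pd_unitmx pX; rewrite qform_invmx//.
have -> : (u^T *m v) 0 0 = bform X u (invmx X *m v).
  by rewrite /bform -mulmxA mulKVmx.
exact/cauchy_schwarz/pd_psd.
Qed.

(** Each coordinate of [v] is a dot product with a basis vector, so [dot_le_qform] bounds its
    square; summing produces [k], the trace of [X^-1]. No compactness of the sphere is involved. *)
Lemma pd_coercive X : X^T = X -> pd X ->
  exists2 c : F, 0 < c & forall v, c * qform 1%:M v <= qform X v.
Proof.
move=> sX pX; have piX := pd_psd (pd_invmx sX pX).
pose k := \sum_i qform (invmx X) (delta_mx i 0).
have k0 : 0 <= k by rewrite sumr_ge0.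
exists (1 + k)^-1; first by rewrite invr_gt0 ltr_pwDl.
move=> v; rewrite mulrC ler_pdivrMr ?ltr_pwDl//.
apply: (@le_trans _ _ (qform X v * k)); last first.
  by rewrite ler_wpM2l ?lerDr ?(pd_psd pX).
rewrite qform1 mulr_sumr; apply: ler_sum => i _.
apply: le_trans (dot_le_qform _ _ sX pX).
by rewrite -colE mxE mxE.
Qed.

(** Each product [|v_i| |v_j|] is at most [|v|^2], whence the factor [n ^ 2]. With coercivity, it
    shows that positivity survives small entrywise changes. *)
Lemma qform_le_entries (X : 'M[F]_n) e v : (forall i j, `|X i j| <= e) ->
  `|qform X v| <= e * (n ^ 2)%:R * qform 1%:M v.
Proof.
move=> Xe; have -> : e * (n ^ 2)%:R * qform 1%:M v =
    \sum_(i < n) \sum_(j < n) (e * qform 1%:M v).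
  under eq_bigr do rewrite sumr_const card_ord.
  by rewrite sumr_const card_ord -mulrnA mulnn -mulr_natl; ring.
rewrite /qform bform_sum -/(qform _ _).
apply: le_trans (ler_norm_sum _ _ _) _; apply: ler_sum => i _.
apply: le_trans (ler_norm_sum _ _ _) _; apply: ler_sum => j _.
rewrite !normrM mulrAC mulrC; apply: ler_pM; rewrite ?mulr_ge0//.
have := le_qform1 v i; have := le_qform1 v j.
rewrite -(real_normK (num_real (v i 0))) -(real_normK (num_real (v j 0))).
have := sqr_ge0 (`|v i 0| - `|v j 0|); rewrite sqrrB -mulr_natl.
move: `|v i 0| `|v j 0| (qform _ _) => a b q {Xe}; lra.
Qed.

End Forms.

(** * Positivity along a polynomial path of matrices *)

Section Path.
Local Open Scope classical_set_scope.
Variables (R : realType) (n : nat).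

(** Makes [0 <= qform (Z t) v] a polynomial inequality in [t], hence a closed condition. *)
Lemma qform_horner (p : 'M[{poly R}]_n) (v : 'cV[R]_n) :
  exists q : {poly R}, forall t, qform (map_mx (horner_eval t) p) v = q.[t].
Proof.
exists (((map_mx polyC v)^T *m p *m map_mx polyC v) 0 0) => t.
rewrite -[RHS]/(horner_eval t _) /qform /bform.
transitivity ((map_mx (horner_eval t) ((map_mx polyC v)^T *m p *m map_mx polyC v)) 0 0).
  rewrite !map_mxM map_trmx; do 4 f_equal; rewrite -map_mx_comp;
  by apply/matrixP => i j; rewrite !mxE/= /horner_eval hornerC.
by rewrite mxE.
Qed.

(* The set of [t] in [0,1] with a positive semidefinite form is closed, and open
   because each of its forms is coercive. *)
Lemma pd_path (p : 'M[{poly R}]_n) (Z := fun t => map_mx (horner_eval t) p) :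
  (forall t : R, 0 <= t <= 1 -> (Z t)^T = Z t) ->
  (forall t : R, 0 <= t <= 1 -> psd (Z t) -> pd (Z t)) ->
  psd (Z 0) -> pd (Z 1).
Proof.
move=> symZ pdZ Z0.
have nearZ (t : R) : 0 <= t <= 1 -> psd (Z t) -> \forall s \near t, psd (Z s).
  move=> t01 pZt; have [c c0 cZ] := pd_coercive (symZ t t01) (pdZ t t01 pZt).
  (* Chosen so that [e * n ^ 2 <= c]; the added 1 covers [n = 0]. *)
  pose e := c / ((n ^ 2)%:R + 1).
  have e0 : 0 < e by rewrite divr_gt0// ltr_wpDl.
  have : \forall s \near t, forall i j, `|(Z s - Z t) i j| <= e.
    apply: (@filter_forall R _ (fun i s => forall j, `|(Z s - Z t) i j| <= e)
      (nbhs t) _) => i.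
    apply: (@filter_forall R _ (fun j s => `|(Z s - Z t) i j| <= e) (nbhs t) _) => j.
    have /cvgrPdist_le/(_ _ e0) := @continuous_horner R (p i j) t.
    by apply: filterS => s /=; rewrite distrC !mxE.
  apply: filterS => s Zs v.
  have -> : Z s = Z t + (Z s - Z t) by rewrite addrC subrK.
  rewrite qformD; have := qform_le_entries v Zs; have := cZ v.
  rewrite ler_norml => cv /andP[+ _].
  suff : e * (n ^ 2)%:R * qform 1%:M v <= c * qform 1%:M v by lra.
  rewrite ler_wpM2r ?qform1_ge0// /e mulrAC ler_pdivrMr ?ltr_wpDl//.
  by rewrite ler_wpM2l ?lerDl ?ltW.
have : [set t | 0 <= t <= 1 /\ psd (Z t)] = `[0, 1].
  apply: (@segment_connected R 0 1).
  - by exists 0; split=> //; rewrite lexx ler01.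
  - exists (interior [set t | psd (Z t)]); first exact: open_interior.
    apply/seteqP; split=> t /=; rewrite in_itv/= => -[t01].
      by move=> pt; split=> //; exact: nearZ.
    by move=> /nbhs_singleton.
  - exists (\bigcap_v [set t | 0 <= qform (Z t) v]).
      apply: closed_bigI => v _; have [q qE] := qform_horner p v.
      have -> : [set t | 0 <= qform (Z t) v] = horner q @^-1` [set x | 0 <= x].
        by apply/seteqP; split=> t /=; rewrite qE.
      apply: preimage_closed (@closed_ge _ 0) => t _; exact: continuous_horner.
    apply/seteqP; split=> t /=; rewrite in_itv/= => -[t01].
      by move=> pt; split=> // v _ /=.
    by move=> pt; split=> // v; exact: pt.
move=> /seteqP[_ /(_ 1)]/=; rewrite in_itv/= ler01 lexx => /(_ isT)[_].
by apply: pdZ; rewrite ler01 lexx.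
Qed.

End Path.

(** * The Lyapunov operator, its Kronecker matrix and positivity of its solutions *)

Section Lyapunov.
Variables (R : realType) (n m : nat) (A : 'M[R]_n) (N : 'I_m -> 'M[R]_n).
Implicit Types (X Y W : 'M[R]_n).

Definition lyap X := A *m X + X *m A^T + \sum_(k < m) (N k *m X *m (N k)^T).

Lemma lyapD X Y : lyap (X + Y) = lyap X + lyap Y.
Proof.
rewrite /lyap mulmxDr mulmxDl; under eq_bigr do rewrite mulmxDr mulmxDl.
by rewrite big_split/= (addrACA (A *m X)) (addrACA (A *m X + _)).
Qed.

Lemma lyapZ a X : lyap (a *: X) = a *: lyap X.
Proof.
rewrite /lyap -scalemxAr -scalemxAl !scalerDr; congr (_ + _).
by rewrite scaler_sumr; apply: eq_bigr => k _; rewrite -scalemxAr -scalemxAl.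
Qed.

Lemma lyap_tr X : (lyap X)^T = lyap X^T.
Proof.
rewrite /lyap !linearD/= !trmx_mul trmxK [X in X + _]addrC; congr (_ + _).
by rewrite linear_sum; apply: eq_bigr => k _; rewrite /= !trmx_mul trmxK mulmxA.
Qed.

Lemma qform_lyap X v : X^T = X -> qform (lyap X) v =
  2 * bform X v (A^T *m v) + \sum_k qform X ((N k)^T *m v).
Proof.
move=> sX; rewrite /lyap !qformD qform_sum; congr (_ + _); last first.
  by apply: eq_bigr => k _; rewrite qform_conj.
have -> : qform (X *m A^T) v = bform X v (A^T *m v) by rewrite /qform /bform !mulmxA.
have -> : qform (A *m X) v = bform X (A^T *m v) v.
  by rewrite /qform /bform trmx_mul trmxK !mulmxA.
by rewrite (bformC _ _ sX); ring.
Qed.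

(** Vectorisation in the index order of [*t], so that [M1 *t M2] acts as [X |-> M1 X M2^T] with its
    factors in the same order. *)
Definition stackmx X : 'cV[R]_(n * n) :=
  \col_k X (mxtens_unindex k).1 (mxtens_unindex k).2.
Definition unstackmx (c : 'cV[R]_(n * n)) : 'M[R]_n :=
  \matrix_(i, j) c (mxtens_index (i, j)) 0.

Lemma stackmxK : cancel stackmx unstackmx.
Proof. by move=> X; apply/matrixP => i j; rewrite !mxE mxtens_indexK. Qed.

Lemma unstackmxK : cancel unstackmx stackmx.
Proof.
move=> c; apply/colP => k; rewrite !mxE.
by case: (mxtens_indexP k) => i j; rewrite mxtens_indexK.
Qed.

Lemma stackmxD X Y : stackmx (X + Y) = stackmx X + stackmx Y.
Proof. by apply/colP => k; rewrite !mxE. Qed.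

Lemma stackmxZ a X : stackmx (a *: X) = a *: stackmx X.
Proof. by apply/colP => k; rewrite !mxE. Qed.

Lemma stackmx_sum (I : finType) (X : I -> 'M[R]_n) :
  stackmx (\sum_i X i) = \sum_i stackmx (X i).
Proof. by apply/colP => k; rewrite mxE !summxE; apply: eq_bigr => i _; rewrite mxE. Qed.

Lemma tensmx_stackmx (M1 M2 X : 'M[R]_n) :
  (M1 *t M2) *m stackmx X = stackmx (M1 *m X *m M2^T).
Proof.
apply/colP => k; rewrite !mxE; case: (mxtens_indexP k) => i j.
rewrite !mxtens_indexK/=.
transitivity (\sum_(l : 'I_n * 'I_n) M1 i l.1 * M2 j l.2 * X l.1 l.2).
  rewrite (reindex (@mxtens_index n n)).
    by apply: eq_bigr => -[a b] _; rewrite !mxE !mxtens_indexK.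
  by exists (@mxtens_unindex n n) => l _; rewrite (mxtens_indexK, mxtens_unindexK).
rewrite -(pair_bigA _ (fun a b => M1 i a * M2 j b * X a b))/= exchange_big/=.
apply: eq_bigr => b _; rewrite !mxE mulr_suml; apply: eq_bigr => a _.
by rewrite mulrAC.
Qed.

Lemma kron_stackmx X : kron_op A N *m stackmx X = stackmx (lyap X).
Proof.
rewrite /kron_op !mulmxDl mulmx_suml !tensmx_stackmx trmx1 mulmx1 mul1mx.
under eq_bigr do rewrite tensmx_stackmx.
by rewrite -stackmx_sum -!stackmxD.
Qed.

Hypothesis specK : spec_in_Cminus (kron_op A N).

(** The matrix of the homotopy from the identity to [- lyap]. *)
Definition kron_path (t : R) := (1 - t)%:M - t *: kron_op A N.

Lemma kron_path_stackmx t X :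
  kron_path t *m stackmx X = stackmx ((1 - t) *: X - t *: lyap X).
Proof.
rewrite mulmxBl mul_scalar_mx -scalemxAl kron_stackmx.
by apply/colP => k; rewrite !mxE.
Qed.

(** For [t > 0], a kernel vector would be an eigenvector of the Kronecker matrix for the nonnegative
    real number [(1 - t) / t], against the spectral condition. *)
Lemma det_kron_path (t : R) : 0 <= t <= 1 -> \det (kron_path t) != 0.
Proof.
move=> /andP[t0 t1]; apply/negP => /det0P[v v0].
rewrite mulmxBr mul_mx_scalar -scalemxAr => /eqP; rewrite subr_eq0 => /eqP vE.
have [tz|tn0] := eqVneq t 0.
  by move: vE v0; rewrite tz subr0 scale1r scale0r => ->; rewrite eqxx.
have vK : v *m kron_op A N = ((1 - t) / t) *: v.
  by rewrite [_ / _]mulrC -scalerA vE scalerA mulVf// scale1r.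
have /specK/= : eigenvalue (map_mx (fun r => (r%:C)%C) (kron_op A N)) (((1 - t) / t)%:C)%C.
  apply/eigenvalueP; exists (map_mx (real_complex R) v).
    by rewrite -map_mxM vK map_mxZ.
  by rewrite map_mx_eq0.
rewrite (Creal_ReP _ _) ?complex_real// ltcR.
by rewrite ltNge divr_ge0// subr_ge0.
Qed.

Lemma kron_op_path1 : kron_op A N = - kron_path 1.
Proof. by rewrite /kron_path subrr scale1r raddf0 sub0r opprK. Qed.

Lemma kron_unitmx : kron_op A N \in unitmx.
Proof.
rewrite kron_op_path1 -scaleN1r unitmxZ ?unitrN1// unitmxE unitfE det_kron_path//.
by rewrite ler01 lexx.
Qed.

Lemma lyap_inj : injective lyap.
Proof.
move=> X Y XY; apply: (can_inj stackmxK).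
by apply: (can_inj (mulKmx kron_unitmx)); rewrite !kron_stackmx XY.
Qed.

Lemma lyap_surj W : exists X, lyap X = W.
Proof.
exists (unstackmx (invmx (kron_op A N) *m stackmx W)); apply: (can_inj stackmxK).
by rewrite -kron_stackmx unstackmxK mulKVmx// kron_unitmx.
Qed.

Lemma lyap_pd X W : W^T = W -> pd W -> lyap X = - W -> X^T = X /\ pd X.
Proof.
(* The transpose of [X] solves the same equation, so uniqueness gives symmetry. *)
move=> sW pW XW; have sX : X^T = X by apply: lyap_inj; rewrite -lyap_tr XW linearN/= sW.
split=> //.
pose KP : 'M[{poly R}]_(n * n) :=
  (1 - 'X)%:M - 'X *: map_mx polyC (kron_op A N).
have KPE t : map_mx (horner_eval t) KP = kron_path t.
  apply/matrixP => i j; rewrite !mxE/= /horner_eval !hornerE hornerMn !hornerE.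
  by [].
(* The adjugate replaces the inverse to keep the path polynomial in [t]; the extra determinant turns
   the right-hand side into [\det ^+ 2 *: W], a positive multiple of [W]. *)
pose zp := \det KP *: (\adj KP *m map_mx polyC (stackmx W)).
pose p : 'M[{poly R}]_n := \matrix_(i, j) zp (mxtens_index (i, j)) 0.
pose Z t := map_mx (horner_eval t) p.
have ZE t : Z t = unstackmx (\det (kron_path t) *: (\adj (kron_path t) *m stackmx W)).
  rewrite -KPE det_map_mx -map_mx_adj; apply/matrixP => i j.
  rewrite [LHS]mxE [RHS]mxE mxE.
  have -> : stackmx W = map_mx (horner_eval t) (map_mx polyC (stackmx W)).
    by apply/colP => k; rewrite !mxE/= /horner_eval hornerC.
  by rewrite -map_mxM -map_mxZ [RHS]mxE.
have SZ t : (1 - t) *: Z t - t *: lyap (Z t) = \det (kron_path t) ^+ 2 *: W.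
  apply: (can_inj stackmxK); rewrite -kron_path_stackmx ZE unstackmxK -scalemxAr mulmxA.
  by rewrite mul_mx_adj mul_scalar_mx scalerA -expr2 stackmxZ.
have kinj t : 0 <= t <= 1 -> injective (fun Y => (1 - t) *: Y - t *: lyap Y).
  move=> /det_kron_path dt Y1 Y2 /(congr1 stackmx); rewrite -!kron_path_stackmx => e.
  apply: (can_inj stackmxK); apply: (can_inj (mulKmx _)) e.
  by rewrite unitmxE unitfE.
have symZ t : 0 <= t <= 1 -> (Z t)^T = Z t.
  move=> t01; apply: (kinj t t01); rewrite SZ -lyap_tr.
  by rewrite -[in RHS]sW -[RHS]linearZ/= -SZ linearB/= !linearZ.
have : pd (Z 1).
  apply: pd_path => //.
  (* If the semidefinite [Z t] has a null vector [v], Cauchy-Schwarz kills every [bform (Z t) v w].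
     In [SZ] evaluated at [v] only the terms of the [N k] remain, with a nonpositive sign, while the
     right-hand side is positive. *)
  - move=> t t01 pZ v v0; rewrite lt0r pZ andbT; apply/negP => /eqP qv0.
    have bv0 w : bform (Z t) v w = 0.
      apply/eqP; rewrite -sqrf_eq0 eq_le sqr_ge0 andbT.
      by rewrite (le_trans (cauchy_schwarz _ _ (symZ t t01) pZ))// qv0 mul0r.
    have : qform (\det (kron_path t) ^+ 2 *: W) v <= 0.
      rewrite -SZ qformD -scaleNr !qformZ qv0 mulr0 add0r (qform_lyap _ (symZ t t01)).
      rewrite bv0 mulr0 add0r mulNr oppr_le0 mulr_ge0//; first by case/andP: t01.
      by rewrite sumr_ge0.
    by rewrite leNgt qformZ mulr_gt0 ?pW// exprn_even_gt0//= det_kron_path.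
  - have := SZ 0; rewrite scale0r !subr0 scale1r => Z0.
    by apply: pd_psd => v v0; rewrite -/(Z 0) Z0 qformZ mulr_gt0 ?pW// exprn_even_gt0//=
      det_kron_path// lexx ler01.
suff -> : Z 1 = \det (kron_path 1) ^+ 2 *: X.
  move=> pZ v /pZ; rewrite qformZ pmulr_rgt0// exprn_even_gt0//= det_kron_path//.
  by rewrite lexx ler01.
apply: lyap_inj; apply: oppr_inj; rewrite lyapZ XW scalerN opprK -SZ.
by rewrite subrr scale0r scale1r sub0r.
Qed.

End Lyapunov.

(** * The pointwise energy inequality *)

Section Dissipation.
Variables (F : realType) (n m : nat).

(* Completing squares in [w = P^-1 x]: the terms [2 w^T B v] and
   [2 v_k w^T N_k P w] are absorbed by [|B^T w|^2] and by the quadratic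
   terms of the Lyapunov operator. *)
Lemma dissipation (A P : 'M[F]_n) (N : 'I_m -> 'M[F]_n) (B : 'M[F]_(n, m))
    (x : 'cV[F]_n) (v : 'cV[F]_m) :
  P^T = P -> pd P ->
  (forall w, qform (lyap A N P) w <= - \sum_k ((B^T *m w) k 0) ^+ 2) ->
  2 * bform (invmx P) x (A *m x + B *m v + \sum_k (v k 0 *: (N k *m x))) <=
  \sum_k v k 0 ^+ 2
  + (\sum_k (if N k == 0 then 0 else v k 0) ^+ 2) * qform (invmx P) x.
Proof.
move=> sP pP lyapP; have uP := pd_unitmx pP.
pose w := invmx P *m x; have xE : x = P *m w by rewrite mulKVmx.
rewrite (qform_invmx _ sP uP) -/w.
have dotw (z : 'cV_n) : bform (invmx P) x z = (w^T *m z) 0 0.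
  by rewrite /bform /w trmx_mul sym_invmx.
clearbody w; rewrite !bformDr !dotw.
have -> : (w^T *m (A *m x)) 0 0 = bform P w (A^T *m w).
  by rewrite (bformC _ _ sP) /bform trmx_mul trmxK xE !mulmxA.
have -> : (w^T *m (B *m v)) 0 0 = \sum_k (B^T *m w) k 0 * v k 0.
  rewrite mulmxA mxE; apply: eq_bigr => k _; congr (_ * _).
  by rewrite -[B in LHS]trmxK -trmx_mul mxE.
have -> : (w^T *m (\sum_k v k 0 *: (N k *m x))) 0 0 =
    \sum_k v k 0 * bform P ((N k)^T *m w) w.
  rewrite mulmx_sumr summxE; apply: eq_bigr => k _.
  by rewrite -scalemxAr mxE /bform trmx_mul trmxK xE !mulmxA.
have := lyapP w; rewrite (qform_lyap _ _ _ sP) => lyapw.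
have Bw : \sum_k (2 * ((B^T *m w) k 0 * v k 0) - ((B^T *m w) k 0) ^+ 2)
    <= \sum_k v k 0 ^+ 2.
  apply: ler_sum => k _; have := sqr_ge0 ((B^T *m w) k 0 - v k 0); nra.
have Nw : \sum_k (2 * (v k 0 * bform P ((N k)^T *m w) w)
     - qform P ((N k)^T *m w))
    <= (\sum_k (if N k == 0 then 0 else v k 0) ^+ 2) * qform P w.
  rewrite mulr_suml; apply: ler_sum => k _; case: eqP => [->|_].
    by rewrite trmx0 mul0mx /qform !bform0 (bformC _ _ sP) bform0 expr0n/= mul0r !mulr0 subrr.
  (* The square completed in the [P]-form. The case [N k = 0] contributes nothing on either side,
     which is how [u0] enters in place of [u]. *)
  have := pd_psd pP ((N k)^T *m w + - v k 0 *: w).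
  rewrite /qform !(bformDl, bformDr, bformZl, bformZr).
  rewrite (bformC w _ sP) => h; rewrite -subr_ge0.
  by move: h; congr (_ <= _); ring.
move: Bw Nw; rewrite !sumrB -!mulr_sumr; lra.
Qed.

End Dissipation.

(** * Increments of functions and Lebesgue integrals on intervals *)

Section Analysis.
Local Open Scope classical_set_scope.
Variable R : realType.
Local Notation mu := (@lebesgue_measure R).

(** Telescoping over a uniform partition of mesh below [d] bounds the total increment of [F] by
    [e * (g T - g 0)], with [e] arbitrary. It stands in for the sign of a derivative. *)
Lemma increments_small_le (F g : R -> R) (T : R) : 0 <= T ->
  (forall e : R, 0 < e -> exists2 d, 0 < d &
    forall s t : R, 0 <= s -> s <= t -> t <= T -> t - s < d ->
      F t - F s <= e * (g t - g s)) ->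
  F T <= F 0.
Proof.
move=> T0 Fg; rewrite -subr_le0; apply/ler_addgt0Pr => e e0; rewrite add0r.
pose K := `|g T - g 0| + 1; have K0 : 0 < K by rewrite ltr_wpDl.
have [d d0 dP] := Fg (e / K) (divr_gt0 e0 K0).
(* The Archimedean bound brings the mesh [T / k] below [d]; the successor keeps [k] nonzero. *)
pose k := (Num.bound (T / d)).+1.
have kd : T / k%:R < d.
  rewrite ltr_pdivrMr ?ltr0n// -ltr_pdivrMl// mulrC.
  have Td : 0 <= T / d by rewrite divr_ge0// ltW.
  by rewrite (lt_le_trans (archi_boundP Td))// ler_nat.
pose s i := T * (i%:R / k%:R).
have ss i : s i.+1 - s i = T / k%:R by rewrite /s -mulrBr -mulrBl -natrB// subSnn mul1r.
have s0 : s 0%N = 0 by rewrite /s mul0r mulr0.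
have sk : s k = T by rewrite /s divff ?mulr1// pnatr_eq0.
have -> : F T - F 0 = \sum_(0 <= i < k) (F (s i.+1) - F (s i)).
  by rewrite telescope_sumr// s0 sk.
apply: (@le_trans _ _ (\sum_(0 <= i < k) (e / K * (g (s i.+1) - g (s i))))).
  rewrite [leLHS]big_nat [leRHS]big_nat; apply: ler_sum => i /andP[_ ik].
  apply: dP; [| | |by rewrite ss].
  - by rewrite mulr_ge0// divr_ge0.
  - by rewrite -subr_ge0 ss divr_ge0.
  - by rewrite ler_piMr// ler_pdivrMr ?ltr0n// mul1r ler_nat.
rewrite -mulr_sumr telescope_sumr// s0 sk mulrAC ler_pdivrMr//.
rewrite ler_pM2l// /K; have := ler_norm (g T - g 0); lra.
Qed.

Local Notation ig D f := (mu.-integrable D (EFin \o f)).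

Lemma igD D f g : measurable D -> ig D f -> ig D g -> ig D (fun r => f r + g r).
Proof. by move=> mD If Ig; exact: integrableD If Ig. Qed.

Lemma igZ D k f : measurable D -> ig D f -> ig D (fun r => k * f r).
Proof. by move=> mD If; exact: integrableZl If. Qed.

Lemma ig_norm D f : ig D f -> ig D (fun r => `|f r|).
Proof. by move=> If; exact: integrable_norm. Qed.

Lemma ig_sum D (I : Type) (s : seq I) (f : I -> R -> R) : measurable D ->
  (forall i, ig D (f i)) -> ig D (fun r => \sum_(i <- s) f i r).
Proof.
move=> mD If.
have := @integrable_sum _ _ _ mu D mD I s xpredT (fun i => EFin \o f i)
  (fun i _ => If i).
by congr integrable; apply/funext => r /=; rewrite sumEFin.
Qed.

Lemma Rintegral_sum D (I : Type) (s : seq I) (f : I -> R -> R) : measurable D ->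
  (forall i, ig D (f i)) ->
  \int[mu]_(r in D) (\sum_(i <- s) f i r) = \sum_(i <- s) \int[mu]_(r in D) f i r.
Proof.
move=> mD If; elim: s => [|i s IHs].
  by under eq_Rintegral do rewrite big_nil; rewrite big_nil Rintegral_cst// mul0r.
under eq_Rintegral do rewrite big_cons.
by rewrite big_cons RintegralD// ?IHs//; exact: (ig_sum s mD If).
Qed.

Lemma ig_sub (D E : set R) f : measurable E -> measurable D -> D `<=` E ->
  ig E f -> ig D f.
Proof. by move=> mE mD DE; exact: integrableS. Qed.

Lemma Rintegral_increment (f : R -> R) (T s t : R) : ig `[0, T] f ->
  0 <= s -> s <= t -> t <= T ->
  \int[mu]_(r in `[0, t]) f r - \int[mu]_(r in `[0, s]) f r
  = \int[mu]_(r in `]s, t]) f r.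
Proof.
move=> If s0 st tT; rewrite Rintegral_itvB ?bnd_simp//.
by apply: ig_sub If => // r /=; rewrite !in_itv/= => /andP[-> rt]; exact: le_trans tT.
Qed.

(** Absolute continuity of the integral, applied to [f] extended by zero outside [[0, T]]. *)
Lemma Rintegral_norm_small (f : R -> R) (T : R) : ig `[0, T] f ->
  forall e : R, 0 < e -> exists2 d, 0 < d &
    forall s t : R, 0 <= s -> s <= t -> t <= T -> t - s < d ->
      \int[mu]_(r in `]s, t]) `|f r| < e.
Proof.
move=> If e e0.
have Ifr : mu.-integrable setT (EFin \o (f \_ `[0, T])).
  by have /integrable_mkcond := If => /(_ (measurable_itv _)); rewrite restrict_EFin.
have [d [d0 dP]] := integral_normr_continuous Ifr e0.
exists d => // s t s0 st tT tsd.
have -> : \int[mu]_(r in `]s, t]) `|f r| = \int[mu]_(r in `]s, t]) `|(f \_ `[0, T]) r|.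
  apply: eq_Rintegral => r; rewrite inE/= in_itv/= => /andP[sr rt].
  rewrite patchE mem_set//= in_itv/= (le_trans rt tT) andbT.
  by rewrite ltW// (le_lt_trans s0 sr).
apply: dP; first exact: measurable_itv.
suff : (mu `]s, t] < d%:E)%E by [].
rewrite lebesgue_measure_itv/= !lte_fin.
by case: ifPn => _; rewrite ?lte_fin -?EFinB ?lte_fin.
Qed.

End Analysis.

(** * Gronwall's inequality for a quadratic form along an integral curve *)

Section Gronwall.
Local Open Scope classical_set_scope.
Variables (R : realType) (n : nat).
Local Notation mu := (@lebesgue_measure R).
Local Notation ig D f := (mu.-integrable D (EFin \o f)).

Lemma bform_row (Y : 'M[R]_n) u v : bform Y u v = \sum_j (u^T *m Y) 0 j * v j 0.
Proof. by rewrite /bform mxE. Qed.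

Lemma bform_le_entries (Y : 'M[R]_n) (u v : 'cV[R]_n) c d :
  (forall i, `|u i 0| <= c) -> (forall i, `|v i 0| <= d) ->
  `|bform Y u v| <= (\sum_i \sum_j `|Y i j|) * (c * d).
Proof.
move=> uc vd; rewrite bform_sum mulr_suml.
apply: le_trans (ler_norm_sum _ _ _) _; apply: ler_sum => i _.
rewrite mulr_suml; apply: le_trans (ler_norm_sum _ _ _) _; apply: ler_sum => j _.
by rewrite !normrM mulrAC mulrC ler_wpM2l// ler_pM.
Qed.

(** A difference of squares: it makes energy increments linear in [x t - x s], hence integrals of
    [f]. *)
Lemma qform_sub (Y : 'M[R]_n) u v : Y^T = Y ->
  qform Y u - qform Y v = bform Y (u + v) (u - v).
Proof.
move=> sY; rewrite bformDl !bformDr -(scaleN1r v) !bformZr (bformC v u sY).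
by rewrite /qform; ring.
Qed.

(** Unprimed quantities belong to the later time. The growth [V' * db] is absorbed by the decay of
    the weight, as [E * (1 + db) <= E']; the remaining terms are multiplied by [E <= 1]. *)
Lemma weighted_increment_le (E E' V V' da db dg e : R) :
  0 <= E <= 1 -> E * (1 + db) <= E' -> 0 <= V' -> 0 <= e ->
  0 <= da -> 0 <= db -> 0 <= dg ->
  V - V' <= da + ((V' + e) * db + e * dg) ->
  E * V - E' * V' - da <= e * (db + dg).
Proof.
move=> /andP[E0 E1] EE' V0 e0 a0 b0 g0 dV.
have h1 : E * V <= E * (V' + (da + ((V' + e) * db + e * dg))).
  by apply: ler_wpM2l => //; rewrite -lerBlDl.
have h2 : E * (1 + db) * V' <= E' * V' by exact: ler_wpM2r.
have h3 : E * (da + e * (db + dg)) <= da + e * (db + dg).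
  by apply: ler_piMl E1; apply: addr_ge0 a0 _; exact: mulr_ge0 e0 (addr_ge0 b0 g0).
move: h1 h2 h3; clear; lra.
Qed.

(* With [b(t) = \int_0^t b] and [a(t) = \int_0^t a], the increments over [s, t] of
   [exp (- b(t)) * qform Y (x t) - a(t)] are at most [e] times those of
   [b(t) + \int_0^t \sum_i |f_i|], because [x] is uniformly continuous; no
   differentiation of absolutely continuous functions is needed. *)
Lemma gronwall_qform (Y : 'M[R]_n) (x f : R -> 'cV[R]_n) (a b : R -> R) (T : R) :
  Y^T = Y -> psd Y -> 0 <= T ->
  (forall i, ig `[0, T] (fun r => f r i 0)) ->
  (forall t : R, 0 <= t <= T -> forall i, x t i 0 = \int[mu]_(r in `[0, t]) f r i 0) ->
  ig `[0, T] a -> ig `[0, T] b ->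
  (forall r : R, 0 <= a r) -> (forall r : R, 0 <= b r) ->
  (forall r : R, 0 <= r <= T -> 2 * bform Y (x r) (f r) <= a r + b r * qform Y (x r)) ->
  qform Y (x T) <=
    expR (\int[mu]_(r in `[0, T]) b r) * \int[mu]_(r in `[0, T]) a r.
Proof.
move=> sY pY T0 If xE Ia Ib a0 b0 diss.
(* The integral of [g] bounds the variation of every coordinate of [x]. *)
pose g (r : R) := \sum_i `|f r i 0|.
have fg r i : `|f r i 0| <= g r by rewrite /g (bigD1 i)//= lerDl sumr_ge0.
have Ig : ig `[0, T] g.
  by apply: ig_sum => // i; exact: ig_norm (If i).
pose K : R := \sum_i \sum_j `|Y i j|.
have K0 : 0 <= K by rewrite sumr_ge0// => i _; rewrite sumr_ge0.
pose I (h : R -> R) (t : R) : R := \int[mu]_(r in `[0, t]) h r.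
have I0 (h : R -> R) : I h 0 = 0 by rewrite /I set_itv1 Rintegral_set1.
have sub (s t : R) : 0 <= s -> t <= T -> `]s, t] `<=` `[0, T].
  move=> s0 tT r /=; rewrite !in_itv/= => /andP[sr rt].
  by rewrite (le_trans rt tT) andbT ltW// (le_lt_trans s0).
have Isub (s t : R) (h : R -> R) : 0 <= s -> t <= T -> ig `[0, T] h -> ig `]s, t] h.
  by move=> s0 tT Ih; apply: ig_sub Ih => //; exact: sub.
have dI (h : R -> R) (s t : R) : ig `[0, T] h -> 0 <= s -> s <= t -> t <= T ->
    \int[mu]_(r in `]s, t]) h r = I h t - I h s.
  by move=> Ih s0 st tT; rewrite (Rintegral_increment Ih).
have I_ge0 (h : R -> R) t : (forall r : R, 0 <= h r) -> 0 <= I h t.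
  by move=> h0; exact: Rintegral_ge0.
have dI_ge0 (h : R -> R) (s t : R) : ig `[0, T] h -> (forall r : R, 0 <= h r) ->
    0 <= s -> s <= t -> t <= T -> 0 <= I h t - I h s.
  by move=> Ih h0 s0 st tT; rewrite -dI//; exact: Rintegral_ge0.
have g0 r : 0 <= g r by rewrite sumr_ge0.
have dx (s t : R) i : 0 <= s -> s <= t -> t <= T -> `|x t i 0 - x s i 0| <= I g t - I g s.
  move=> s0 st tT; rewrite !xE ?s0 ?(le_trans st) ?(le_trans s0)//.
  rewrite (Rintegral_increment (If i))// -dI//.
  apply: le_trans (le_normr_Rintegral _ (Isub s t _ s0 tT (If i))) _ => //.
  by apply: le_Rintegral => //; [exact/ig_norm/Isub/(If i)|exact: Isub].
pose M := I g T; have M0 : 0 <= M by exact: I_ge0.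
have xM (t : R) i : 0 <= t -> t <= T -> `|x t i 0| <= M.
  move=> t0 tT; have x00 : x 0 i 0 = 0 by rewrite xE ?lexx// set_itv1 Rintegral_set1.
  have := dx 0 t i (lexx 0) t0 tT; rewrite x00 subr0 I0 subr0 => /le_trans; apply.
  by rewrite -subr_ge0 dI_ge0.
pose F (t : R) := expR (- I b t) * qform Y (x t) - I a t.
pose G (t : R) := I b t + I g t.
have : F T <= F 0.
  apply: (@increments_small_le R F G T T0) => e e0.
  (* Both errors below, [2 * eta * K] and [2 * K * M * eta], must be at most [e] for
     [eta = e / k]. *)
  pose k := 2 * K * M + 2 * K + 1.
  have KM0 : 0 <= K * M by rewrite mulr_ge0.
  have k0 : 0 < k by rewrite /k -!mulrA; lra.
  pose eta := e / k.
  have eta0 : 0 < eta by rewrite divr_gt0.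
  have etae : eta * k = e by rewrite divfK// gt_eqF.
  have etaK : 2 * eta * K <= e.
    have := mulr_ge0 (ltW eta0) KM0; rewrite -etae /k; lra.
  have etaKM : K * (2 * M * eta) <= e.
    have := mulr_ge0 (ltW eta0) K0; rewrite -etae /k; lra.
  have [d d0 dP] := Rintegral_norm_small Ig eta0.
  exists d => // s t s0 st tT tsd.
  have t0 := le_trans s0 st; have sT := le_trans st tT.
  have dG : I g t - I g s <= eta.
    rewrite -dI//; have := dP s t s0 st tT tsd => /ltW; congr (_ <= _).
    by apply: eq_Rintegral => r _; rewrite ger0_norm.
  have dxr (r : R) i : s <= r -> r <= t ->
      `|x r i 0 - x s i 0| <= eta /\ `|x t i 0 - x r i 0| <= eta.
    move=> sr rt; have r0 := le_trans s0 sr; have rT := le_trans rt tT.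
    have := dI_ge0 g s r Ig g0 s0 sr rT; have := dI_ge0 g r t Ig g0 r0 rt tT.
    have := dx s r i s0 sr rT; have := dx r t i r0 rt tT; move: dG.
    by move=> *; split; lra.
  pose V (r : R) := qform Y (x r).
  have VE : V t - V s = \int[mu]_(r in `]s, t]) bform Y (x t + x s) (f r).
    rewrite /V qform_sub// bform_row.
    under eq_Rintegral do rewrite bform_row.
    rewrite Rintegral_sum//; last by move=> j; exact/igZ/Isub/If.
    apply: eq_bigr => j _; rewrite RintegralZl//; last exact/Isub/If.
    by congr (_ * _); rewrite dI// !mxE !xE ?s0 ?t0.
  (* Here [V s + e] bounds [qform Y (x r)] on []s, t]], and [e * g r] pays for replacing [x t + x s]
     by [2 *: x r]. *)
  pose h (r : R) := a r + ((V s + e) * b r + e * g r).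
  have Ih : ig `[0, T] h by apply: igD => //; apply: igD => //; exact: igZ.
  have dV : V t - V s <= I h t - I h s.
    rewrite VE -dI//; apply: le_Rintegral => //.
    - under [X in EFin \o X]eq_fun do rewrite bform_row.
      by apply: ig_sum => // j; exact/igZ/Isub/If.
    - exact: Isub.
    - move=> r /=; rewrite in_itv/= => /andP[/ltW sr rt].
      have r0 := le_trans s0 sr; have rT := le_trans rt tT.
      have rr i := dxr r i sr rt.
      have -> : x t + x s = 2 *: x r + (x t + x s - 2 *: x r) by rewrite [RHS]addrC subrK.
      rewrite bformDl bformZl.
      have b1 : `|bform Y (x t + x s - 2 *: x r) (f r)| <= K * (2 * eta * g r).
        apply: bform_le_entries (fg r) => i; rewrite !mxE.
        have [] := rr i; rewrite !ler_norml; lra.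
      have b2 : `|bform Y (x r + x s) (x r - x s)| <= K * (2 * M * eta).
        apply: bform_le_entries => i; rewrite !mxE; last by case: (rr i).
        by have := xM r i r0 rT; have := xM s i s0 sT; rewrite !ler_norml; lra.
      have := diss r; rewrite r0 rT => /(_ isT).
      have -> : qform Y (x r) = V s + bform Y (x r + x s) (x r - x s).
        by rewrite -qform_sub// /V [RHS]addrC subrK.
      move: b1 b2; rewrite !ler_norml => /andP[_ b1] /andP[_ b2].
      have b3 : b r * bform Y (x r + x s) (x r - x s) <= b r * e.
        by rewrite ler_wpM2l// (le_trans b2).
      have b4 : K * (2 * eta * g r) <= e * g r.
        by rewrite mulrA [K * _]mulrC ler_wpM2r.
      rewrite /h; lra.
  have IhE r : r <= T -> I h r = I a r + ((V s + e) * I b r + e * I g r).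
    move=> rT.
    have sr : `[0, r] `<=` `[0, T].
      by move=> q /=; rewrite !in_itv/= => /andP[-> qr]; exact: le_trans rT.
    have Ir k' : ig `[0, T] k' -> ig `[0, r] k' by move=> Ik; apply: ig_sub Ik.
    rewrite /I /h RintegralD//; [|exact: Ir|by apply: igD => //; apply: igZ => //; exact: Ir].
    rewrite RintegralD//; [|exact/igZ/Ir|exact/igZ/Ir].
    by rewrite !RintegralZl//; exact: Ir.
  move: dV; rewrite !IhE// => dV.
  have a1 := dI_ge0 a s t Ia a0 s0 st tT.
  have b1 := dI_ge0 b s t Ib b0 s0 st tT.
  have g1 := dI_ge0 g s t Ig g0 s0 st tT.
  have E1 : expR (- I b t) <= 1 by rewrite -expR0 ler_expR oppr_le0 I_ge0.
  have E0 : 0 < expR (- I b t) by exact: expR_gt0.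
  (* This is [1 + z <= exp z] for the increment [z] of the integral of [b]. *)
  have E2 : expR (- I b t) * (1 + (I b t - I b s)) <= expR (- I b s).
    have -> : expR (- I b s) = expR (- I b t) * expR (I b t - I b s).
      by rewrite -expRD; congr expR; ring.
    by rewrite ler_pM2l// expR_ge1Dx.
  have Vs0 : 0 <= V s by exact: pY.
  have := weighted_increment_le (da := I a t - I a s) (db := I b t - I b s)
    (dg := I g t - I g s) (V := V t) (E := expR (- I b t)) _ E2 Vs0 (ltW e0) a1 b1 g1.
  rewrite ltW// E1 => /(_ isT) h1.
  have : V t - V s <= I a t - I a s + ((V s + e) * (I b t - I b s) + e * (I g t - I g s)).
    by apply: le_trans dV _; rewrite le_eqVlt; apply/orP; left; apply/eqP; ring.
  move=> /h1; rewrite /F /G -!/(V _) => h2.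
  have -> : I b t + I g t - (I b s + I g s) = I b t - I b s + (I g t - I g s) by ring.
  apply: le_trans h2; rewrite le_eqVlt; apply/orP; left; apply/eqP; ring.
(* Since [x 0 = 0], [F 0] vanishes, and [F T <= 0] rearranges to the claim. *)
rewrite /F !I0 oppr0 expR0 mul1r addr0.
have -> : qform Y (x 0) = 0.
  suff -> : x 0 = 0 by rewrite /qform bform0.
  by apply/colP => i; rewrite mxE xE ?lexx// set_itv1 Rintegral_set1.
rewrite subr_le0 expRN mulrC ler_pdivrMr ?expR_gt0// mulrC.
by [].
Qed.

End Gronwall.

(** * Energy bound for the bilinear system *)

Section EnergyBound.
Local Open Scope classical_set_scope.
Variables (R : realType) (n m : nat).
Local Notation mu := (@lebesgue_measure R).
Local Notation ig D f := (mu.-integrable D (EFin \o f)).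

(** Gronwall with [a = |u|^2] and [b = |u0|^2]; their integrals over [[0, t]] are then enlarged to
    the half-line, which removes [t] from the bound. *)
Lemma energy_bound (A P : 'M[R]_n) (N : 'I_m -> 'M[R]_n) (B : 'M[R]_(n, m))
    (u : R -> 'cV[R]_m) (x : R -> 'cV[R]_n) (t : R) :
  0 <= t -> P^T = P -> pd P ->
  (forall w, qform (lyap A N P) w <= - \sum_k ((B^T *m w) k 0) ^+ 2) ->
  in_L2 u -> bil_solution A B N u x ->
  qform (invmx P) (x t) <= expR (L2norm2 (u0 N u)) * L2norm2 u.
Proof.
move=> t0 sP pP lyapP [mu_u Iu] solx.
pose a (r : R) := \sum_(k < m) u r k 0 ^+ 2.
pose b (r : R) := \sum_(k < m) u0 N u r k 0 ^+ 2.
have a0 r : 0 <= a r by rewrite sumr_ge0// => k _; rewrite sqr_ge0.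
have b0 r : 0 <= b r by rewrite sumr_ge0// => k _; rewrite sqr_ge0.
have ba r : b r <= a r.
  apply: ler_sum => k _; rewrite mxE; case: ifP => // _.
  by rewrite expr0n/= sqr_ge0.
have mb : measurable_fun (`[0, +oo[ : set R) b.
  apply: measurable_sum => k; apply: measurable_realfun.measurable_funX.
  have -> : (fun r => u0 N u r k 0) = fun r => if N k == 0 then 0 else u r k 0.
    by apply/funext => r; rewrite mxE.
  by case: (N k == 0); [exact: measurable_cst|exact: mu_u].
have Ib : ig (`[0, +oo[ : set R) b.
  apply: le_integrable Iu => //; first exact/measurable_realfun.measurable_EFinP.
  by move=> r _ /=; rewrite lee_fin ger0_norm//; exact: le_trans (ba r) (ler_norm _).
have sub : `[0, t] `<=` (`[0, +oo[ : set R).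
  by move=> r /=; rewrite !in_itv/= => /andP[->].
have le_L2 (f : R -> R) : (forall r, 0 <= f r) -> ig (`[0, +oo[ : set R) f ->
    \int[mu]_(r in `[0, t]) f r <= \int[mu]_(r in `[0, +oo[) f r.
  move=> f0 If; have Ift : ig `[0, t] f by apply: ig_sub If.
  apply: fine_le; [exact: integrable_fin_num..|].
  apply: ge0_subset_integral => //; first exact: measurable_int If.
  by move=> r _; rewrite lee_fin.
have := @gronwall_qform R n (invmx P) x (bil_rhs A B N u x) a b t
  (sym_invmx sP) (pd_psd (pd_invmx sP pP)) t0.
move=> /(_ (fun i => (solx t t0 i).1)).
move=> /(_ (fun r r0 i => (solx r (proj1 (andP r0)) i).2)).
have Iat : ig `[0, t] a by apply: ig_sub Iu.
have Ibt : ig `[0, t] b by apply: ig_sub Ib.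
move=> /(_ Iat Ibt a0 b0).
have diss (r : R) : 0 <= r <= t ->
    2 * bform (invmx P) (x r) (bil_rhs A B N u x r) <= a r + b r * qform (invmx P) (x r).
  move=> _; have := dissipation (x r) (u r) sP pP lyapP.
  by congr (_ <= _ + _ * _); apply: eq_bigr => k _; rewrite mxE.
move=> /(_ diss) /le_trans; apply; apply: ler_pM; rewrite ?expR_ge0 ?Rintegral_ge0//.
  by rewrite ler_expR; exact: le_L2.
exact: le_L2.
Qed.

End EnergyBound.

(** * Regularisation of the Lyapunov solution and the output bound *)

Theorem theorem4p1 (R : realType) (n m p : nat)
    (A : 'M[R]_n) (N : 'I_m -> 'M[R]_n) (B : 'M[R]_(n, m)) (C : 'M[R]_(p, n))
    (u : R -> 'cV[R]_m) (x : R -> 'cV[R]_n) :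
  hurwitz A ->
  in_L2 u ->
  bil_solution A B N u x ->
  spec_in_Cminus (kron_op A N) ->
  (exists! P : 'M[R]_n, lyap_eq A N B P) /\
  (forall P : 'M[R]_n, lyap_eq A N B P ->
     forall t : R, 0 <= t ->
       norm2 (C *m x t) <=
         Num.sqrt (\tr (C *m P *m C^T)) * expR (2^-1 * L2norm2 (u0 N u)) * L2norm u).
Proof.
move=> _ uL2 solx specK; split.
  have [P PE] := lyap_surj specK (- (B *m B^T)); exists P; split=> // P' P'E.
  by apply: (lyap_inj specK); rewrite PE -P'E.
move=> P PE t t0.
have [Q QE] := lyap_surj specK (- 1%:M).
have key e : 0 < e -> \sum_i (C *m x t) i 0 ^+ 2 <=
    (\tr (C *m P *m C^T) + e * \tr (C *m Q *m C^T)) *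
    (expR (L2norm2 (u0 N u)) * L2norm2 u).
  move=> e0.
  have -> : \tr (C *m P *m C^T) + e * \tr (C *m Q *m C^T)
      = \tr (C *m (P + e *: Q) *m C^T).
    by rewrite mulmxDr mulmxDl -scalemxAr -scalemxAl mxtraceD mxtraceZ.
  (* The multiple of the identity makes [W] positive definite whatever the rank of [B], as [lyap_pd]
     requires. *)
  pose W := B *m B^T + e *: 1%:M.
  have sW : W^T = W by rewrite /W linearD linearZ/= trmx_mul trmxK trmx1.
  have qW v : qform W v = \sum_k ((B^T *m v) k 0) ^+ 2 + e * qform 1%:M v.
    rewrite /W qformD qformZ; congr (_ + _); rewrite -{1}[B]mulmx1 qform_conj.
    by rewrite -[LHS]/(qform 1%:M (B^T *m v)) qform1.
  have pW : pd W.
    move=> v v0; rewrite qW ltr_wpDl ?mulr_gt0 ?qform1_gt0//.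
    by rewrite sumr_ge0// => k _; rewrite sqr_ge0.
  have WE : lyap A N (P + e *: Q) = - W.
    by rewrite lyapD lyapZ QE [lyap A N P]PE /W opprD scalerN.
  have [sP pP] := lyap_pd specK sW pW WE.
  have xt := energy_bound t0 sP pP _ uL2 solx.
  have {}xt : qform (invmx (P + e *: Q)) (x t) <= expR (L2norm2 (u0 N u)) * L2norm2 u.
    apply: xt => w; rewrite WE -scaleN1r qformZ qW mulN1r lerN2 lerDl.
    by rewrite mulr_ge0 ?qform1_ge0// ltW.
  (* Row by row: the [i]-th diagonal entry of the trace is the form [P + e *: Q] at the [i]-th row
     of [C], and [dot_le_qform] bounds the [i]-th output. *)
  rewrite /mxtrace mulr_suml; apply: ler_sum => i _.
  pose c := (row i C)^T.
  have -> : (C *m x t) i 0 = (c^T *m x t) 0 0 by rewrite trmxK -row_mul [RHS]mxE.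
  have -> : (C *m (P + e *: Q) *m C^T) i i = qform (P + e *: Q) c.
    rewrite /qform /bform trmxK -row_mul [LHS]mxE [RHS]mxE.
    by apply: eq_bigr => j _; congr (_ * _); [rewrite [RHS]mxE|rewrite !mxE].
  apply: le_trans (dot_le_qform _ _ sP pP) _.
  by rewrite ler_wpM2l// pd_psd.
have k0 : 0 <= expR (L2norm2 (u0 N u)) * L2norm2 u.
  by rewrite mulr_ge0 ?expR_ge0// Rintegral_ge0// => r _; rewrite sumr_ge0// => i _; rewrite sqr_ge0.
have le : \sum_i (C *m x t) i 0 ^+ 2 <=
    \tr (C *m P *m C^T) * (expR (L2norm2 (u0 N u)) * L2norm2 u).
  apply/ler_addgt0Pr => e e0.
  (* Bounds the coefficient of the regularisation parameter in [key]; the added 1 allows division by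
     [q]. *)
  pose q := `|\tr (C *m Q *m C^T)| * (expR (L2norm2 (u0 N u)) * L2norm2 u) + 1.
  have q0 : 0 < q by rewrite ltr_wpDl// mulr_ge0.
  apply: le_trans (key (e / q) (divr_gt0 e0 q0)) _.
  rewrite mulrDl lerD2l -mulrA mulrAC ler_pdivrMr// ler_pM2l//.
  by rewrite (le_trans (ler_wpM2r k0 (ler_norm _)))// /q lerDl.
rewrite /norm2 /L2norm.
have -> : expR (2^-1 * L2norm2 (u0 N u)) = Num.sqrt (expR (L2norm2 (u0 N u))).
  rewrite -[RHS](ger0_norm (sqrtr_ge0 _)).
  apply/eqP; rewrite -(eqrXn2 (n := 2))// ?expR_ge0// real_normK ?num_real//.
  by rewrite sqr_sqrtr ?expR_ge0// -expRM_natl mulrA mulfV ?mul1r.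
rewrite -mulrA -sqrtrM ?expR_ge0//.
(* For a negative trace [Num.sqrt] returns 0; then [le] makes the sum of squares nonpositive, so the
   left side is 0 too. *)
have [tr0|tr0] := leP 0 (\tr (C *m P *m C^T)).
  by rewrite -sqrtrM// ler_wsqrtr.
rewrite (ler0_sqrtr (ltW tr0)) mul0r ler0_sqrtr//.
by rewrite (le_trans le)// nmulr_rle0.
Qed.
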